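(* Let $m\geq 3$ and let $R$ be a local ring with $\frac12\in R$. Then $$\big([\mathrm{O}_{2m}(R[X]),\mathrm{O}_{2m}(R[X])]\perp I_2\big)\subseteq \mathrm{EO}_{2m+2}(R[X]),$$ that is, for every $\alpha$ in the commutator subgroup of $\mathrm{O}_{2m}(R[X])$, the matrix $\alpha\perp I_2$ lies in $\mathrm{EO}_{2m+2}(R[X])$.
   Context: All rings are commutative with $1\neq 0$. Let $\phi_1=\begin{bmatrix}0&1\\1&0\end{bmatrix}$ and $\phi_n=\phi_{n-1}\perp\phi_1$ for $n>1$, where $\alpha\perp\beta$ denotes the block diagonal matrix with blocks $\alpha,\beta$. For a ring $A$, $\mathrm{O}_{2m}(A)=\{\alpha\in \mathrm{GL}_{2m}(A)\mid \alpha^t\phi_m\alpha=\phi_m\}$. Let $\sigma$ be the permutation of the natural numbers with $\sigma(2i)=2i-1$, $\sigma(2i-1)=2i$. For $1\leq i\neq j\leq 2m$ with $i\neq\sigma(j)$ and $z\in A$, put $oe_{ij}(z)=I_{2m}+zE_{ij}-zE_{\sigma(j)\sigma(i)}$, where $E_{ij}$ is the matrix unit. The elementary orthogonal group $\mathrm{EO}_{2m}(A)$ is the subgroup of $\mathrm{O}_{2m}(A)$ generated by all the $oe_{ij}(z)$. *)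

(* Defs.v *)
From HB Require Import structures.
From mathcomp Require Import all_boot all_order all_algebra.

Set Implicit Arguments.
Unset Strict Implicit.
Unset Printing Implicit Defensive.

Import GRing.Theory.
Local Open Scope ring_scope.

(* Ideals are Prop-valued so that arbitrary, possibly undecidable, ideals are
   allowed. *)
Definition is_ideal (R : comNzRingType) (I : R -> Prop) : Prop :=
  [/\ I 0,
      forall x y, I x -> I y -> I (x + y)
    & forall a x, I x -> I (a * x)].

Definition is_maximal_ideal (R : comNzRingType) (M : R -> Prop) : Prop :=
  [/\ is_ideal M,
      ~ M 1
    & forall J : R -> Prop, is_ideal J -> ~ J 1 ->
        (forall x, M x -> J x) -> forall x, J x -> M x].

Definition is_local_ring (R : comNzRingType) : Prop :=
  exists M : R -> Prop,
    is_maximal_ideal M /\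
    forall N : R -> Prop, is_maximal_ideal N -> forall x, N x <-> M x.

(* [unitmx] needs decidable units in the coefficient ring, which [{poly R}]
   lacks when R is not a domain; hence the explicit two-sided inverses. *)
Definition is_inverse_mx (A : comNzRingType) (n : nat) (a b : 'M[A]_n) : Prop :=
  a *m b = 1%:M /\ b *m a = 1%:M.

Definition general_linear_group (A : comNzRingType) (n : nat)
    (a : 'M[A]_n) : Prop :=
  exists b, is_inverse_mx a b.

(* Meant for sets S of invertible matrices. *)
Inductive generated_subgroup (A : comNzRingType) (n : nat)
    (S : 'M[A]_n -> Prop) : 'M[A]_n -> Prop :=
  | generated_in a : S a -> generated_subgroup S a
  | generated_one : generated_subgroup S 1%:M
  | generated_mul a b : generated_subgroup S a -> generated_subgroup S b ->
      generated_subgroup S (a *m b)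
  | generated_inv a b : generated_subgroup S a -> is_inverse_mx a b ->
      generated_subgroup S b.

Definition is_commutator (A : comNzRingType) (n : nat)
    (H K : 'M[A]_n -> Prop) (c : 'M[A]_n) : Prop :=
  exists a a' b b' : 'M[A]_n,
    [/\ H a, K b, is_inverse_mx a a', is_inverse_mx b b'
      & c = a *m b *m a' *m b'].

Definition commutator_subgroup (A : comNzRingType) (n : nat)
    (H K : 'M[A]_n -> Prop) : 'M[A]_n -> Prop :=
  generated_subgroup (is_commutator H K).

Lemma double_add2 (n : nat) : (n.*2 + 2)%N = n.+1.*2.
Proof. by rewrite addn2 doubleS. Qed.

(* a _|_ b, with the size n.*2 + 2 cast to n.+1.*2 *)
Definition perp2 (A : comNzRingType) (n : nat)
    (a : 'M[A]_(n.*2)) (b : 'M[A]_2) : 'M[A]_(n.+1.*2) :=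
  castmx (double_add2 n, double_add2 n) (block_mx a 0 0 b).

Definition phi1 (A : comNzRingType) : 'M[A]_2 :=
  \matrix_(i, j) (i != j)%:R.

(* Starts from the empty matrix: phi A 1 is phi1 A. *)
Fixpoint phi (A : comNzRingType) (n : nat) : 'M[A]_(n.*2) :=
  if n is n'.+1 then perp2 (phi A n') (phi1 A) else 0.

Definition orthogonal_group (A : comNzRingType) (m : nat)
    (a : 'M[A]_(m.*2)) : Prop :=
  general_linear_group a /\ a^T *m phi A m *m a = phi A m.

(* Ordinals start at 0, so sigma exchanges 2k and 2k + 1. *)
Definition sigma_nat (k : nat) : nat := if odd k then k.-1 else k.+1.

Lemma sigma_subproof (m : nat) (i : 'I_(m.*2)) : (sigma_nat i < m.*2)%N.
Proof.
rewrite /sigma_nat; case: ifP => oi.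
  exact: leq_ltn_trans (leq_pred _) (ltn_ord i).
rewrite ltn_neqAle ltn_ord andbT; apply: contraFneq oi => e.
by rewrite -[odd i]negbK -[~~ odd i]/(odd i.+1) e odd_double.
Qed.

Definition sigma (m : nat) (i : 'I_(m.*2)) : 'I_(m.*2) :=
  Ordinal (sigma_subproof i).

Definition oe (A : comNzRingType) (m : nat) (i j : 'I_(m.*2)) (z : A) :
    'M[A]_(m.*2) :=
  1%:M + z *: delta_mx i j - z *: delta_mx (sigma j) (sigma i).

Definition is_elementary_generator (A : comNzRingType) (m : nat)
    (a : 'M[A]_(m.*2)) : Prop :=
  exists (i j : 'I_(m.*2)) (z : A), [/\ i != j, i != sigma j & a = oe i j z].

Definition elementary_orthogonal_group (A : comNzRingType) (m : nat) :
    'M[A]_(m.*2) -> Prop :=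
  generated_subgroup (@is_elementary_generator A m).

(* Main.v *)
(* For u with q(u) = s invertible let tau_u be the reflection in u.  The point is
   that an isometry g with g u = u + s u' commutes with tau_u modulo the subgroup
   generated by the transvections E(w), F(w) along the two isotropic vectors e, f
   of the added hyperbolic plane: g tau_u g^-1 tau_u^-1 = tau_(g u) tau_u, and the
   chain u, u + s e, g u + s q(u') f, g u of vectors of length s splits this
   product into three factors, each of which is a product of such transvections
   without denominators.  The identity is polynomial, so that it makes sense when
   s is not invertible, provided that the congruence g = 1 mod s is witnessed by
   an explicit quotient.

   As 2 is invertible, over a local ring every isometry b is a product of
   reflections: one moves the vectors of an orthogonal basis to their places one
   at a time, because q(x - y) + q(x + y) = 4 q(y) when q(x) = q(y).  Run without
   dividing over an arbitrary ring, this elimination shows that the d such that b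
   commutes, modulo transvections, with all isometries congruent to 1 modulo d
   generate the unit ideal.  This replaces the local-global principle: write
   1 = k_1 d_1 + ... + k_r d_r with such d_i for b(X), and telescope a(X t) from
   t = 0 to t = 1 along the partial sums; every quotient of consecutive terms is
   congruent to 1 modulo some d_i.  The remaining a(0) is defined over the local
   ring R, where one of the moduli attached to it is a unit. *)
Require Import Defs.
From HB Require Import structures.
From mathcomp Require Import all_boot all_order all_algebra.
From mathcomp Require Import ring zify boolp classical_sets.

Set Implicit Arguments.
Unset Strict Implicit.
Unset Printing Implicit Defensive.

Import GRing.Theory.
Local Open Scope ring_scope.

(** * The index pairing and the matrix of the hyperbolic form *)

Lemma odd_sigma_nat k : odd (sigma_nat k) = ~~ odd k.
Proof.
rewrite /sigma_nat; case: (boolP (odd k)) => ok /=; last by rewrite ok.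
by case: k ok => //= k /negbTE ->.
Qed.

Lemma sigma_natK : involutive sigma_nat.
Proof.
move=> k; rewrite {1}/sigma_nat odd_sigma_nat /sigma_nat.
by case: (boolP (odd k)) => // ok; case: k ok.
Qed.

Lemma sigmaK m : involutive (@sigma m).
Proof. by move=> i; apply: val_inj; exact: sigma_natK. Qed.

Lemma sigma_neq m (i : 'I_(m.*2)) : (i == sigma i) = false.
Proof.
apply/eqP => e; have := odd_sigma_nat i.
by rewrite -[sigma_nat i]/(val (sigma i)) -e; case: odd.
Qed.

Lemma sigma_nat_lt2 n k : (sigma_nat k < n.*2)%N = (k < n.*2)%N.
Proof.
have H l : (l < n.*2)%N -> (sigma_nat l < n.*2)%N.
  by move=> lt_l; exact: (ltn_ord (sigma (Ordinal lt_l))).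
by apply/idP/idP => /H //; rewrite sigma_natK.
Qed.

Lemma sigma_natD2 n k : sigma_nat (n.*2 + k) = (n.*2 + sigma_nat k)%N.
Proof.
rewrite /sigma_nat oddD odd_double /=; case: (boolP (odd k)) => [ok|_].
  by case: k ok => // k _; rewrite addnS.
by rewrite addnS.
Qed.

Lemma phiE (A : comNzRingType) m (i j : 'I_(m.*2)) :
  phi A m i j = (i == sigma j)%:R.
Proof.
elim: m i j => [|m IH] i j; first by case: i.
rewrite /= /perp2 castmxE /= /phi1.
set i' := cast_ord _ i; set j' := cast_ord _ j.
have -> : (i == sigma j) = (val i' == sigma_nat (val j')) by [].
rewrite -[i']splitK -[j']splitK.
case: (split i') (split j') => [k|k] [l|l] /=.
- by rewrite block_mxEul IH.
- rewrite block_mxEur mxE; case: eqP => // e; have := ltn_ord k.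
  by rewrite e sigma_nat_lt2 ltnNge leq_addr.
- rewrite block_mxEdl mxE; case: eqP => // e; have := ltn_ord l.
  by rewrite -sigma_nat_lt2 -e ltnNge leq_addr.
rewrite block_mxEdr mxE; congr (_ %:R).
rewrite sigma_natD2 eqn_add2l.
by case: k l => [[|[|k]] //= ?] [[|[|l]] //= ?].
Qed.

Lemma phi_tr (A : comNzRingType) m : (phi A m)^T = phi A m.
Proof.
by apply/matrixP=> i j; rewrite mxE !phiE eq_sym (can2_eq (@sigmaK m) (@sigmaK m)).
Qed.

Lemma mul_phi_delta (A : comNzRingType) m (j : 'I_(m.*2)) :
  phi A m *m delta_mx j 0 = delta_mx (sigma j) 0 :> 'cV_(m.*2).
Proof.
by rewrite -colE; apply/matrixP=> i k; rewrite !mxE phiE (ord1 k) andbT.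
Qed.

Lemma phi_sq (A : comNzRingType) m : phi A m *m phi A m = 1%:M.
Proof.
apply/matrixP => i j.
have /colP/(_ i) : phi A m *m phi A m *m delta_mx j 0 = delta_mx j 0 :> 'cV_(_).
  by rewrite -mulmxA !mul_phi_delta sigmaK.
by rewrite -colE [LHS]mxE => ->; rewrite !mxE andbT.
Qed.

(** * The bilinear form and its adjoint *)

Section Forms.
Variables (A : comNzRingType) (m : nat).
Local Notation V := 'cV[A]_(m.*2).
Implicit Types (u v w : V) (a b : 'M[A]_(m.*2)) (k : A).

(* [dual], [adj], [pdual] and [diag_vec] are locked: otherwise rewriting with
   [mulmxA], [mulmxDr] or [mxE] would unfold them. *)
Fact dual_key : unit. Proof. by []. Qed.
Definition dual : V -> 'rV_(m.*2) := locked_with dual_key (fun u => u^T *m phi A m).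
Lemma dualE u : dual u = u^T *m phi A m.
Proof. by rewrite /dual unlock. Qed.
Fact adj_key : unit. Proof. by []. Qed.
Definition adj : 'M[A]_(m.*2) -> 'M[A]_(m.*2) :=
  locked_with adj_key (fun b => phi A m *m b^T *m phi A m).
Lemma adjE b : adj b = phi A m *m b^T *m phi A m.
Proof. by rewrite /adj unlock. Qed.
Definition form u v : A := (dual u *m v) 0 0.

Lemma dualD u v : dual (u + v) = dual u + dual v.
Proof. by rewrite !dualE linearD mulmxDl. Qed.
Lemma dualZ k u : dual (k *: u) = k *: dual u.
Proof. by rewrite !dualE linearZ /= -scalemxAl. Qed.
Lemma dualN u : dual (- u) = - dual u.
Proof. by rewrite !dualE linearN mulNmx. Qed.

Lemma adjD a b : adj (a + b) = adj a + adj b.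
Proof. by rewrite !adjE linearD mulmxDr mulmxDl. Qed.
Lemma adjZ k b : adj (k *: b) = k *: adj b.
Proof. by rewrite !adjE linearZ /= -scalemxAr -scalemxAl. Qed.
Lemma adjN b : adj (- b) = - adj b.
Proof. by rewrite !adjE linearN mulmxN mulNmx. Qed.
Lemma adjM a b : adj (a *m b) = adj b *m adj a.
Proof.
by rewrite !adjE trmx_mul !mulmxA -[_ *m phi A m *m phi A m]mulmxA phi_sq mulmx1.
Qed.
Lemma adj_scalar k : adj k%:M = k%:M.
Proof. by rewrite !adjE tr_scalar_mx mul_mx_scalar -scalemxAl phi_sq scalemx1. Qed.
Lemma adjK b : adj (adj b) = b.
Proof.
rewrite !adjE !trmx_mul trmxK phi_tr !mulmxA phi_sq mul1mx -mulmxA phi_sq.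
by rewrite mulmx1.
Qed.
Lemma dual_mulmx b u : dual (b *m u) = dual u *m adj b.
Proof.
by rewrite !dualE adjE trmx_mul !mulmxA -[_ *m phi A m *m phi A m]mulmxA phi_sq mulmx1. Qed.
Lemma adj_outer u v : adj (u *m dual v) = v *m dual u.
Proof.
by rewrite !adjE !dualE trmx_mul trmx_mul trmxK phi_tr !mulmxA phi_sq mul1mx.
Qed.

Lemma dual_mul u v : dual u *m v = (form u v)%:M.
Proof. exact: mx11_scalar. Qed.
Lemma mul_dual p (x : 'cV_p) u v : x *m dual u *m v = form u v *: x.
Proof. by rewrite -mulmxA dual_mul mul_mx_scalar. Qed.
Lemma formC u v : form u v = form v u.
Proof.
have -> : form u v = (dual u *m v)^T 0 0 by rewrite mxE.
by rewrite /form !dualE !trmx_mul trmxK phi_tr mulmxA.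
Qed.
Lemma formDl u v w : form (u + v) w = form u w + form v w.
Proof. by rewrite /form dualD mulmxDl mxE. Qed.
Lemma formZl k u w : form (k *: u) w = k * form u w.
Proof. by rewrite /form dualZ -scalemxAl mxE. Qed.
Lemma formNl u w : form (- u) w = - form u w.
Proof. by rewrite /form dualN mulNmx mxE. Qed.
Lemma formDr u v w : form w (u + v) = form w u + form w v.
Proof. by rewrite /form mulmxDr mxE. Qed.
Lemma formZr k u w : form w (k *: u) = k * form w u.
Proof. by rewrite /form -scalemxAr mxE. Qed.
Lemma formNr u w : form w (- u) = - form w u.
Proof. by rewrite /form mulmxN mxE. Qed.
Lemma form_mulmxl b u v : form (b *m u) v = form u (adj b *m v).
Proof. by rewrite /form dual_mulmx mulmxA. Qed.
Definition formE :=
  (formDl, formDr, formNl, formNr, formZl, formZr).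

End Forms.

(** * Eichler transvections and products of two reflections *)

Section Transvections.
Variables (A : comNzRingType) (m : nat) (h : A).
Hypothesis h2 : 2%:R * h = 1.
Local Notation V := 'cV[A]_(m.*2).
Implicit Types (u v w : V) (i : 'I_2) (s : A).

Definition qform w : A := h * form w w.

Lemma formxx w : form w w = 2%:R * qform w.
Proof. by rewrite /qform mulrA h2 mul1r. Qed.

Definition pvec i : 'cV[A]_2 := delta_mx i 0.
Fact pdual_key : unit. Proof. by []. Qed.
Definition pdual : 'I_2 -> 'rV[A]_2 :=
  locked_with pdual_key (fun i => (pvec i)^T *m phi1 A).

Lemma pdualE i : pdual i = delta_mx 0 (rev_ord i).
Proof.
rewrite /pdual unlock trmx_delta -rowE; apply/matrixP=> j k; rewrite !mxE ord1 /=.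
by case: i k => [[|[|i]] //= ?] [[|[|k]] //= ?].
Qed.

Lemma mul_pdual p (x : 'cV_p) i j : x *m pdual i *m pvec j = (i != j)%:R *: x.
Proof.
rewrite -mulmxA pdualE mul_delta_mx_cond.
suff -> : delta_mx 0 0 = 1%:M :> 'M[A]_1.
  rewrite -scaler_nat -scalemxAr mulmx1; congr (_%:R *: _).
  by case: i j => [[|[|i]] //= ?] [[|[|k]] //= ?].
by apply/matrixP=> a b; rewrite !mxE !ord1.
Qed.

(* With respect to the hyperbolic plane spanned by [pvec 0] and [pvec 1], this
   is the Eichler transvection x |-> x + <e, x> w - <w, x> e - q(w) <e, x> e
   with e = [pvec i]. *)
Definition transv i w : 'M[A]_(m.*2 + 2) :=
  block_mx 1%:M (w *m pdual i)
           (- (pvec i *m dual w)) (1%:M - qform w *: (pvec i *m pdual i)).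

Lemma mul_scalemx (k : A) p q r (x : 'M_(p, q)) (y : 'M_(q, r)) :
  (k *: x) *m y = k *: (x *m y).
Proof. by rewrite scalemxAl. Qed.
Lemma mulmx_scale (k : A) p q r (x : 'M_(p, q)) (y : 'M_(q, r)) :
  x *m (k *: y) = k *: (x *m y).
Proof. by rewrite scalemxAr. Qed.

Definition mxexp := (mulmxDl, mulmxDr, mulNmx, mulmxN, mul1mx, mulmx1,
  mul0mx, mulmx0, mul_scalemx, mulmx_scale, mulmxA, mul_pdual, mul_dual,
  dualD, dualN, dualZ).

Ltac mx_entries :=
  repeat match goal with |- context [dual ?u] => generalize (dual u); intro end;
  repeat match goal with |- context [pdual ?u] => generalize (pdual u); intro end;
  apply/matrixP=> ? ?; rewrite !(mxE, big_ord1).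

Lemma transvD i v w : transv i v *m transv i w = transv i (v + w).
Proof.
have qD : qform (v + w) = qform v + qform w + form v w.
  rewrite /qform !formE (formC w v).
  by rewrite -[form v w in RHS]mul1r -h2; ring.
rewrite /transv mulmx_block qD; congr block_mx.
- rewrite !mxexp eqxx /=; mx_entries; ring.
- rewrite !mxexp eqxx /=; mx_entries; ring.
- rewrite !mxexp eqxx /=; mx_entries; ring.
- rewrite !mxexp eqxx /=; mx_entries; ring.
Qed.

Lemma transv0 i : transv i 0 = 1%:M.
Proof.
rewrite /transv mul0mx /qform /form mulmx0 [X in h * X]mxE mulr0 scale0r subr0.
by rewrite dualE trmx0 mul0mx mulmx0 oppr0 -scalar_mx_block.
Qed.

Lemma transvNK i w : transv i w *m transv i (- w) = 1%:M.
Proof. by rewrite transvD subrr transv0. Qed.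
Lemma transvNKl i w : transv i (- w) *m transv i w = 1%:M.
Proof. by rewrite transvD addNr transv0. Qed.

Lemma transv_conj i w (g : 'M_(m.*2)) : adj g *m g = 1%:M -> g *m adj g = 1%:M ->
  block_mx g 0 0 1%:M *m transv i w *m block_mx (adj g) 0 0 1%:M =
  transv i (g *m w).
Proof.
move=> g1 g2; rewrite /transv !mulmx_block !(mulmx0, mul0mx, addr0, add0r).
rewrite !(mulmx1, mul1mx, mulNmx) g2 dual_mulmx !mulmxA.
by rewrite /qform form_mulmxl mulmxA g1 mul1mx.
Qed.

(* The product of the reflections in u + s u' and u, if qform h u = s and
   form u u' + s qform h u' = 0; the denominators s cancel. *)
Definition refl2 u u' s : 'M[A]_(m.*2) :=
  let v := u + s *: u' in
  1%:M + u' *m dual u - v *m dual u' - qform u' *: (v *m dual u).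

(** The second hypothesis is the equation q(u + s u') = q(u) with a factor s cancelled. For v = u +
    s u' and p = q(u') v - u' it yields q(v) = s, q(p) = q(u') and <p, v> = s q(u'). *)
Lemma refl2E u u' s : qform u = s -> form u u' + s * qform u' = 0 ->
  block_mx (refl2 u u' s) 0 0 1%:M =
  transv 1 (qform u' *: (u + s *: u') - u') *m transv 0 (u + s *: u') *m
  (transv 1 u' *m transv 0 (- u)).
Proof.
move=> qu /eqP; rewrite addr_eq0 => /eqP uu'.
have uu : form u u = 2%:R * s by rewrite formxx qu.
have u'u' : form u' u' = 2%:R * qform u' by rewrite formxx.
have u'u : form u' u = - (s * qform u') by rewrite formC.
rewrite /refl2 -/(u + _); move Ev: (u + s *: u') => v.
move Ep: (_ *: v - u') => p; set D := (X in block_mx X).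
(* Multiplying by the inverse of the last pair of transvections leaves an identity without
   denominators, which is checked block by block. *)
suff E : block_mx D 0 0 1%:M *m (transv 0 u *m transv 1 (- u')) =
    transv 1 p *m transv 0 v.
  rewrite -E -!mulmxA (mulmxA (transv 1 (- _))) transvNKl mul1mx transvNK.
  by rewrite mulmx1.
have qv : qform v = s.
  rewrite /qform -Ev !formE uu uu' u'u u'u'.
  transitivity (2%:R * h * s); last by rewrite h2 mul1r.
  ring.
have qN : qform (- u') = qform u' by rewrite /qform !formE opprK.
have vu' : form v u' = s * qform u' by rewrite -Ev !formE uu' u'u'; ring.
have pv : form p v = s * qform u'.
  by rewrite -Ep !formE (formC u') vu' (formxx v) qv; ring.
have qp : qform p = qform u'.
  transitivity (h * (2%:R * qform u')); last by rewrite mulrA (mulrC h) h2 mul1r.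
  rewrite {1}/qform; congr (_ * _).
  rewrite -Ep !formE (formC u' v) vu' (formxx v) u'u' qv; ring.
rewrite /transv !mulmx_block qu qN qv qp /D.
rewrite !(mul0mx, add0r, addr0).
congr block_mx.
- by rewrite !mxexp -Ep -Ev !(mxexp, formE) ?uu ?uu' ?u'u ?u'u' /=; mx_entries; ring.
- by rewrite !mxexp -Ep -Ev !(mxexp, formE) ?uu ?uu' ?u'u ?u'u' /=; mx_entries; ring.
- by rewrite !(mxexp, eqxx) -Ep !mxexp -Ev !mxexp /=; mx_entries; ring.
- by rewrite !(mxexp, formE) ?pv ?uu' /=; mx_entries; ring.
Qed.

End Transvections.

(** * Commutators modulo transvections *)

Section StablyElementary.
Variables (A : comNzRingType) (m : nat) (h : A).
Hypothesis h2 : 2%:R * h = 1.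
Implicit Types (a b g x eta : 'M[A]_(m.*2)) (u v w : 'cV[A]_(m.*2)) (s d c : A).

Definition transv_group : 'M[A]_(m.*2 + 2) -> Prop :=
  generated_subgroup (fun y => exists i w, y = transv h i w).

Definition stably_elementary x := transv_group (block_mx x 0 0 1%:M).

Lemma stably_elementary1 : stably_elementary 1%:M.
Proof.
by rewrite /stably_elementary -scalar_mx_block; exact: generated_one.
Qed.

Lemma stably_elementaryM a b :
  stably_elementary a -> stably_elementary b -> stably_elementary (a *m b).
Proof.
rewrite /stably_elementary => Ea Eb.
suff -> : block_mx (a *m b) 0 0 (1%:M : 'M_2) =
    block_mx a 0 0 1%:M *m block_mx b 0 0 1%:M by exact: generated_mul.
by rewrite mulmx_block !(mulmx0, mul0mx, addr0, add0r, mulmx1).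
Qed.

Lemma stably_elementaryV a b :
  a *m b = 1%:M -> b *m a = 1%:M -> stably_elementary a -> stably_elementary b.
Proof.
move=> ab ba Ea; apply: generated_inv Ea _.
by split; rewrite mulmx_block !(mulmx0, mul0mx, addr0, add0r, mulmx1) ?ab ?ba
  -scalar_mx_block.
Qed.

Definition isometry g := adj g *m g = 1%:M /\ g *m adj g = 1%:M.

Lemma isometryM a b : isometry a -> isometry b -> isometry (a *m b).
Proof.
move=> [a1 a2] [b1 b2]; split; rewrite adjM !mulmxA.
  by rewrite -[_ *m adj a *m a]mulmxA a1 mulmx1.
by rewrite -[_ *m b *m adj b]mulmxA b2 mulmx1.
Qed.

Lemma isometryV a : isometry a -> isometry (adj a).
Proof. by move=> [a1 a2]; split; rewrite adjK. Qed.

Lemma transv_group_conj g (y : 'M_(m.*2 + 2)) : isometry g ->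
  transv_group y ->
  transv_group (block_mx g 0 0 1%:M *m y *m block_mx (adj g) 0 0 1%:M).
Proof.
move=> [g1 g2]; set G := block_mx g 0 0 1%:M; set G' := block_mx _ 0 0 1%:M.
have GG' : G *m G' = 1%:M.
  by rewrite mulmx_block !(mulmx0, mul0mx, addr0, add0r, mulmx1) g2 -scalar_mx_block.
have G'G : G' *m G = 1%:M.
  by rewrite mulmx_block !(mulmx0, mul0mx, addr0, add0r, mulmx1) g1 -scalar_mx_block.
have GM y1 y2 : G *m (y1 *m y2) *m G' = (G *m y1 *m G') *m (G *m y2 *m G').
  by rewrite !mulmxA -[_ *m G' *m G]mulmxA G'G mulmx1.
elim=> [_ [i [w ->]] | | a b _ IHa _ IHb | a b _ IHa [ab ba]].
- by apply: generated_in; exists i, (g *m w); exact: transv_conj.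
- by rewrite mulmx1 GG'; exact: generated_one.
- by rewrite GM; exact: generated_mul.
by apply: generated_inv IHa _; split; rewrite -GM ?ab ?ba mulmx1.
Qed.

Lemma stably_elementary_conj g x : isometry g ->
  stably_elementary x -> stably_elementary (g *m x *m adj g).
Proof.
move=> gi /(transv_group_conj gi).
by rewrite !mulmx_block !(mulmx0, mul0mx, addr0, add0r, mulmx1).
Qed.

Definition commute_mod a b := stably_elementary (a *m b *m adj a *m adj b).

(** The commutator [a1 a2, b] is a1 [a2, b] a1^-1 times [a1, b], and conjugation by an isometry
    permutes the transvections. *)
Lemma commute_modMl a1 a2 b : isometry a1 -> isometry b ->
  commute_mod a1 b -> commute_mod a2 b -> commute_mod (a1 *m a2) b.
Proof.
move=> i1 ib c1 c2; rewrite /commute_mod.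
have -> : a1 *m a2 *m b *m adj (a1 *m a2) *m adj b =
  (a1 *m (a2 *m b *m adj a2 *m adj b) *m adj a1) *m (a1 *m b *m adj a1 *m adj b).
  rewrite adjM !mulmxA -[_ *m adj a1 *m a1]mulmxA i1.1 mulmx1.
  by rewrite -[_ *m adj b *m b]mulmxA ib.1 mulmx1.
by apply: stably_elementaryM => //; exact: stably_elementary_conj.
Qed.

Lemma commute_mod_sym a b : isometry a -> isometry b ->
  commute_mod a b -> commute_mod b a.
Proof.
move=> [a1 a2] [b1 b2]; apply: stably_elementaryV; rewrite !mulmxA.
  rewrite -[_ *m adj b *m b]mulmxA b1 mulmx1 -[_ *m adj a *m a]mulmxA a1 mulmx1.
  by rewrite -[_ *m b *m adj b]mulmxA b2 mulmx1.
rewrite -[_ *m adj a *m a]mulmxA a1 mulmx1 -[_ *m adj b *m b]mulmxA b1 mulmx1.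
by rewrite -[_ *m a *m adj a]mulmxA a2 mulmx1.
Qed.

(* [eta] stands for (g - 1) / c for an isometry g congruent to 1 modulo c;
   the condition is that g is an isometry, divided by c, so that it remains
   usable when c is a zero divisor. *)
Definition congruence c eta :=
  eta + adj eta + c *: (adj eta *m eta) = 0 /\
  eta + adj eta + c *: (eta *m adj eta) = 0.

Lemma congruence_scale c k eta : congruence (k * c) eta -> congruence c (k *: eta).
Proof.
have E : c * k * k = k * (k * c) by ring.
move=> [e1 e2]; split; rewrite adjZ mul_scalemx mulmx_scale !scalerA -scalerDr.
  by rewrite E -scalerA -scalerDr e1 scaler0.
by rewrite E -scalerA -scalerDr e2 scaler0.
Qed.

Lemma congruence_adj c eta : congruence c eta -> congruence c (adj eta).
Proof. by move=> [e1 e2]; split; rewrite adjK [adj _ + _]addrC. Qed.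

Lemma congruence_inv c eta : congruence c eta ->
  (1%:M + c *: eta) *m (1%:M + c *: adj eta) = 1%:M.
Proof.
move=> [_ e2]; rewrite mulmxDl !mulmxDr !mul1mx mulmx1 mul_scalemx mulmx_scale.
by rewrite -addrA addrA -addrA -!scalerDr addrA [adj _ + _]addrC e2 scaler0 addr0.
Qed.

Lemma isometry_congruence c eta : (forall x : 'M[A]_(m.*2), c *: x = 0 -> x = 0) ->
  isometry (1%:M + c *: eta) -> congruence c eta.
Proof.
move=> c_reg [i1 i2]; split; apply: c_reg; apply: (addrI 1%:M).
  rewrite addr0 -[RHS]i1 adjD adjZ adj_scalar mulmxDl !mulmxDr !mul1mx mulmx1.
  by rewrite mul_scalemx mulmx_scale !scalerDr -!addrA; congr (_ + _); rewrite addrCA.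
rewrite addr0 -[RHS]i2 adjD adjZ adj_scalar mulmxDl !mulmxDr !mul1mx mulmx1.
by rewrite mul_scalemx mulmx_scale !scalerDr -!addrA; congr (_ + _); rewrite addrCA.
Qed.

(** A denominator-free substitute for the isometry b / s, meaningful when s is not invertible. *)
Definition similitude b s :=
  adj b *m b = (s ^+ 2)%:M /\ b *m adj b = (s ^+ 2)%:M.

(** The matrix [b *m eta *m adj b] is s^2 times the conjugate of [eta] by b / s, which absorbs the
    factor s^2 of the modulus. *)
Lemma congruence_conj b s c eta : similitude b s ->
  congruence (c * s ^+ 2) eta -> congruence c (b *m eta *m adj b).
Proof.
move=> [b1 b2] [e1 e2].
have E x y : b *m x *m adj b *m (b *m y *m adj b) =
    s ^+ 2 *: (b *m (x *m y) *m adj b).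
  rewrite !mulmxA -[_ *m adj b *m b]mulmxA b1 mul_mx_scalar.
  by rewrite !mul_scalemx.
split; rewrite !adjM adjK mulmxA E scalerA -!mulmxDl -!mulmxDr.
  by rewrite -mul_scalemx -mulmx_scale -mulmxDl -mulmxDr e1 mulmx0 mul0mx.
by rewrite -mul_scalemx -mulmx_scale -mulmxDl -mulmxDr e2 mulmx0 mul0mx.
Qed.

(* For g = 1 + d s^2 eta, the matrix below is the commutator of g and b / s. *)
Definition good b s d := forall eta, congruence (d * s ^+ 2) eta ->
  stably_elementary
    ((1%:M + (d * s ^+ 2) *: eta) *m (1%:M + d *: (b *m adj eta *m adj b))).

Lemma good_scalar s d : good s%:M s d.
Proof.
move=> eta /congruence_inv e; rewrite adj_scalar mul_scalar_mx mul_mx_scalar.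
by rewrite !scalerA -mulrA -expr2 e; exact: stably_elementary1.
Qed.

(** Let g = 1 + d s1^2 s2^2 eta, and let c1, c2 stand for b1 / s1, b2 / s2. Then [g, c1 c2] =
    [g, c2] [c2 g c2^-1, c1]. *)
Lemma good_mul b1 s1 b2 s2 d : similitude b2 s2 ->
  good b1 s1 d -> good b2 s2 d -> good (b1 *m b2) (s1 * s2) d.
Proof.
move=> sb2 g1 g2 eta; rewrite exprMn => ce.
have ce1 : congruence (d * s1 ^+ 2) (b2 *m eta *m adj b2).
  by apply: congruence_conj sb2 _; rewrite -mulrA.
have ce2 : congruence (d * s2 ^+ 2) (s1 ^+ 2 *: eta).
  by apply: congruence_scale; rewrite mulrCA.
have := congruence_inv (congruence_adj ce1); rewrite adjK => YK.
have := stably_elementaryM (g2 _ ce2) (g1 _ ce1).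
set x2 := b2 *m eta *m adj b2 in YK *.
have -> : b2 *m adj (s1 ^+ 2 *: eta) *m adj b2 = s1 ^+ 2 *: adj x2.
  by rewrite adjZ mulmx_scale mul_scalemx !adjM adjK mulmxA.
rewrite !scalerA mulmxA -[_ *m _ *m (1%:M + (d * s1 ^+ 2) *: x2)]mulmxA YK mulmx1.
have -> : b1 *m adj x2 *m adj b1 = b1 *m b2 *m adj eta *m adj (b1 *m b2).
  by rewrite !adjM adjK !mulmxA.
by have -> : d * s2 ^+ 2 * s1 ^+ 2 = d * (s1 ^+ 2 * s2 ^+ 2) by ring.
Qed.

(** Both pairs represent the same isometry b / s, and the moduli d (k s)^2 and (d k^2) s^2 agree. *)
Lemma good_unscale k b s d : good (k *: b) (k * s) d -> good b s (d * k ^+ 2).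
Proof.
move=> gb eta; have E : d * k ^+ 2 * s ^+ 2 = d * (k * s) ^+ 2 by ring.
rewrite E => /gb; rewrite adjZ !(mulmx_scale, mul_scalemx, scalerA).
by rewrite -mulrA -expr2.
Qed.

Lemma good_commute b d eta : good b 1 d -> congruence d eta ->
  isometry b -> commute_mod (1%:M + d *: eta) b.
Proof.
move=> gb ce [b1 b2]; have := gb eta; rewrite expr1n mulr1 => /(_ ce).
rewrite /commute_mod adjD adjZ adj_scalar -!mulmxA; congr (stably_elementary (_ *m _)).
by rewrite !mulmxA mulmxDr mulmxDl mulmx1 b2 mulmx_scale mul_scalemx.
Qed.

(** The reflection in [u] multiplied by q(u), so that q(u) is never inverted. *)
Definition srefl u : 'M[A]_(m.*2) := (qform h u)%:M - u *m dual u.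

Lemma adj_srefl u : adj (srefl u) = srefl u.
Proof. by rewrite adjD adjN adj_scalar adj_outer. Qed.

Lemma srefl_mul u v : srefl u *m v = qform h u *: v - form u v *: u.
Proof. by rewrite mulmxBl mul_scalar_mx mul_dual. Qed.

Lemma srefl_sq u : srefl u *m srefl u = (qform h u ^+ 2)%:M.
Proof.
rewrite {2}/srefl mulmxBr mul_mx_scalar mulmxA srefl_mul (formxx h2).
rewrite mulr_natl mulr2n scalerDl opprD addNKr mulNmx mul_scalemx /srefl.
by rewrite scalerBr scale_scalar_mx opprK subrK -expr2.
Qed.

Lemma srefl_similitude u : similitude (srefl u) (qform h u).
Proof. by split; rewrite adj_srefl srefl_sq. Qed.

(** With g = [N] one has g u = u + s u' for u' = s d (eta u). Hence g tau_u g^-1 tau_u = tau_(g u)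
    tau_u is [refl2 h u u' s], a product of four transvections by [refl2E]. *)
Lemma good_srefl u d : good (srefl u) (qform h u) d.
Proof.
move=> eta; rewrite adj_srefl; set s := qform h u; set c := d * s ^+ 2 => ce.
have NN := congruence_inv ce; have [e1 e2] := ce.
set N := 1%:M + c *: eta in NN *.
pose w := eta *m u; pose x := adj eta *m u.
have du : dual u *m adj eta = dual w by rewrite dual_mulmx.
have Nx : N *m x = - w.
  apply/eqP; rewrite -addr_eq0 mulmxDl mul1mx mul_scalemx /x mulmxA -mul_scalemx.
  by rewrite -!mulmxDl addrAC [adj _ + _]addrC e2 mul0mx.
have Nu : N *m u = u + c *: w by rewrite mulmxDl mul1mx mul_scalemx.
(* This is q(N u) = q(u) divided by c. It comes from the congruence relation paired with [u] and
   halved, so c is never cancelled. *)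
have uw : form u w = - (c * qform h w).
  have : form u ((eta + adj eta + c *: (adj eta *m eta)) *m u) = 0.
    by rewrite e1 mul0mx /form mulmx0 mxE.
  rewrite !mulmxDl mul_scalemx -mulmxA !formE -!form_mulmxl -/w (formC w).
  rewrite (formxx h2 w) => /(congr1 (fun z => h * z)); rewrite mulr0 => E.
  apply/eqP; rewrite -addr_eq0 -E; apply/eqP.
  transitivity (2%:R * h * (form u w + c * qform h w)); first by rewrite h2 mul1r.
  ring.
pose u' := (s * d) *: w.
have v_eq : u + s *: u' = N *m u.
  by rewrite Nu scalerA; congr (_ + _ *: _); rewrite /c; ring.
have qu' : qform h u' = - (d * form u w).
  by rewrite uw /qform !formE /c -/s; ring.
suff -> : N *m (1%:M + d *: (srefl u *m adj eta *m srefl u)) = refl2 h u u' s.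
  rewrite /stably_elementary refl2E //.
    by apply: generated_mul; apply: generated_mul; apply: generated_in; do 2 eexists.
  by rewrite qu' !formE; ring.
have xu : form u x = form w u by rewrite -form_mulmxl.
have -> : srefl u *m adj eta *m srefl u = s ^+ 2 *: adj eta - s *: (x *m dual u)
  - s *: (u *m dual w) + form w u *: (u *m dual u).
  have -> : srefl u *m adj eta = s *: adj eta - u *m dual w.
    by rewrite mulmxBl mul_scalar_mx -mulmxA du.
  rewrite mulmxBr mul_mx_scalar mulmxA mulmxBl mul_scalemx -/x mul_dual.
  rewrite mulmxBl !mul_scalemx -/s.
  move: (adj eta) (x *m _) (u *m dual w) (u *m dual u) => ? ? ? ?.
  by apply/matrixP=> ? ?; rewrite !mxE; ring.
(* As 1 + c [adj eta] is inverse to [N], splitting it off leaves only rank one terms. *)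
have -> (Y : 'M_(m.*2)) :
    1%:M + d *: Y = 1%:M + c *: adj eta + d *: (Y - s ^+ 2 *: adj eta).
  by move: (adj eta) => ?; apply/matrixP=> ? ?; rewrite !mxE /c; ring.
clearbody N x w; rewrite mulmxDr NN mulmx_scale !mxexp Nx Nu /refl2 v_eq Nu qu'.
rewrite !mxexp ?(formC w).
move: (N *m adj eta) (w *m dual u) (u *m dual w) (u *m dual u) (w *m dual w) => ? ? ? ? ?.
  by apply/matrixP=> ? ?; rewrite !mxE /c; ring.
Qed.

End StablyElementary.

(** * Linear combinations of moduli *)

Inductive ideal_span (R : comNzRingType) (P : R -> Prop) : R -> Prop :=
  | ideal_span0 : ideal_span P 0
  | ideal_span_cons k d t : P d -> ideal_span P t -> ideal_span P (k * d + t).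

Section IdealSpan.
Variables (R : comNzRingType) (P : R -> Prop).

Lemma ideal_spanD x y : ideal_span P x -> ideal_span P y -> ideal_span P (x + y).
Proof.
move=> + Py; elim=> [|k d t Pd _ IH]; first by rewrite add0r.
by rewrite -addrA; exact: ideal_span_cons.
Qed.

Lemma ideal_spanMl k x : ideal_span P x -> ideal_span P (k * x).
Proof.
elim=> [|l d t Pd _ IH]; first by rewrite mulr0; exact: ideal_span0.
by rewrite mulrDr mulrA; exact: ideal_span_cons.
Qed.

(** Every term of the binomial expansion has exponent at least K in x or in y. *)
Lemma ideal_span_exp_add x y z K : ideal_span P (x ^+ K * z) ->
  ideal_span P (y ^+ K * z) -> ideal_span P ((x + y) ^+ (K + K) * z).
Proof.
move=> Px Py; rewrite exprDn mulr_suml.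
apply: big_ind => [||i _]; [exact: ideal_span0|exact: ideal_spanD|].
rewrite mulrnAl -mulr_natl; apply: ideal_spanMl.
have [leKi|ltiK] := leqP K i.
  rewrite -(subnK leKi) exprD.
  have -> (p q r : R) : p * (q * r) * z = p * q * (r * z) by ring.
  exact: ideal_spanMl.
have -> : (K + K - i = K - i + K)%N by lia.
rewrite exprD.
have -> (p q r : R) : p * q * r * z = p * r * (q * z) by ring.
exact: ideal_spanMl.
Qed.

End IdealSpan.

Lemma ideal_span_scale (R : comNzRingType) (P Q : R -> Prop) k x :
  (forall d, P d -> Q (d * k)) -> ideal_span P x -> ideal_span Q (x * k).
Proof.
move=> PQ; elim=> [|l d t /PQ Qd _ IH]; first by rewrite mul0r; exact: ideal_span0.
by rewrite mulrDl -mulrA; exact: ideal_span_cons.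
Qed.

(** * Elimination by reflections *)

Section Elimination.
Variables (R : comNzRingType) (m : nat) (h : R).
Hypothesis h2 : 2%:R * h = 1.
Implicit Types (b : 'M[R]_(m.*2)) (s d : R) (j k : 'I_(m.*2)).
Implicit Types (u v : 'cV[R]_(m.*2)).

(** The sum and the difference of the two basis vectors of each hyperbolic plane are orthogonal,
    with q equal to 1 and -1. This sign is the value of q on [diag_vec j]. *)
Definition plane_sign j : R := (-1) ^+ j.

Lemma plane_sign_sq j : plane_sign j * plane_sign j = 1.
Proof. by rewrite -expr2 sqrr_sign. Qed.

Lemma plane_sign_sigma j : plane_sign (sigma j) = - plane_sign j.
Proof.
rewrite /plane_sign -signr_odd odd_sigma_nat -[in RHS]signr_odd.
by case: odd; rewrite ?expr0 ?expr1 ?opprK.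
Qed.

Fact diag_vec_key : unit. Proof. by []. Qed.
Definition diag_vec : 'I_(m.*2) -> 'cV[R]_(m.*2) :=
  locked_with diag_vec_key
    (fun j => delta_mx (sigma j) 0 + plane_sign j *: delta_mx j 0).
Lemma diag_vecE j :
  diag_vec j = delta_mx (sigma j) 0 + plane_sign j *: delta_mx j 0.
Proof. by rewrite /diag_vec unlock. Qed.

Lemma form_delta j k :
  form (delta_mx j 0) (delta_mx k 0 : 'cV[R]_(m.*2)) = (j == sigma k)%:R.
Proof.
by rewrite /form dualE -mulmxA mul_phi_delta trmx_delta -rowE !mxE eqxx andbT.
Qed.

Lemma form_diag_vec j k :
  form (diag_vec j) (diag_vec k) = (2%:R * plane_sign j) *+ (j == k).
Proof.
rewrite !diag_vecE !formE !form_delta sigmaK (inj_eq (can_inj (@sigmaK m))).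
rewrite (can2_eq (@sigmaK m) (@sigmaK m)).
have [->|_] := eqVneq j k.
  by rewrite sigma_neq !(mulr0, addr0, mulr1, add0r) -mulr2n mulr1n mulr_natl.
have [->|_] := eqVneq j (sigma k).
  by rewrite plane_sign_sigma !(mulr0, addr0, mulr1, add0r) mulNr plane_sign_sq subrr.
by rewrite !(mulr0n, mulr0, addr0).
Qed.

Lemma qform_diag_vec j : qform h (diag_vec j) = plane_sign j.
Proof. by rewrite /qform form_diag_vec eqxx mulr1n mulrA [h * _]mulrC h2 mul1r. Qed.

Lemma diag_vec_ext a b : (forall j, a *m diag_vec j = b *m diag_vec j) -> a = b.
Proof.
move=> ab.
have E j : delta_mx j 0 = h *: (plane_sign j *: diag_vec j + diag_vec (sigma j)).
  rewrite !diag_vecE sigmaK plane_sign_sigma [plane_sign j *: (_ + _)]scalerDr.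
  rewrite scalerA plane_sign_sq.
  rewrite scale1r scaleNr addrC addrA subrK.
  by rewrite -mulr2n -scaler_nat scalerA mulrC h2 scale1r.
apply/matrixP=> i j; have /colP/(_ i) : a *m delta_mx j 0 = b *m delta_mx j 0 :> 'cV_(_).
  by rewrite E !(mulmx_scale, mulmxDr) !ab.
by rewrite -!colE !mxE.
Qed.

(** Abstracts [good], which is substituted later after a change of rings. *)
Variable P : 'M[R]_(m.*2) -> R -> R -> Prop.
Hypothesis P_scalar : forall s d, P s%:M s d.
Hypothesis P_srefl : forall u b s d, similitude b s ->
  P (srefl h u *m b) (qform h u * s) d -> P b s (d * qform h u ^+ 4).

Lemma ideal_span_srefl u b s x : similitude b s ->
  ideal_span (P (srefl h u *m b) (qform h u * s)) x ->
  ideal_span (P b s) (x * qform h u ^+ 4).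
Proof. by move=> sb; apply: ideal_span_scale => d; exact: P_srefl. Qed.

Lemma similitudeM a b s t : similitude a s -> similitude b t ->
  similitude (a *m b) (s * t).
Proof.
move=> [a1 a2] [b1 b2]; split; rewrite adjM !mulmxA exprMn.
  by rewrite -[_ *m adj a *m a]mulmxA a1 mul_mx_scalar mul_scalemx b1 scale_scalar_mx.
by rewrite -[_ *m b *m adj b]mulmxA b2 mul_mx_scalar mul_scalemx a2 scale_scalar_mx mulrC.
Qed.

(** For a similitude the second equation follows from the first only up to a factor s, which may be
    a zero divisor. *)
Definition fixes b s v := b *m v = s *: v /\ adj b *m v = s *: v.

Lemma fixes_srefl u b s v : form u v = 0 -> fixes b s v ->
  fixes (srefl h u *m b) (qform h u * s) v.
Proof.
move=> uv [b1 b2]; have E : srefl h u *m v = qform h u *: v.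
  by rewrite srefl_mul uv scale0r subr0.
split; first by rewrite -mulmxA b1 mulmx_scale E scalerA mulrC.
by rewrite adjM adj_srefl -mulmxA E mulmx_scale b2 scalerA.
Qed.

(** Induction on the number [l] of diagonal vectors not yet known to be fixed by b / s. For an
    isometry s = 1, and the span contains 1. *)
Lemma ideal_span_similitude b s : similitude b s ->
  exists N, ideal_span (P b s) (s ^+ N).
Proof.
suff H l : (l <= m.*2)%N -> forall b s, similitude b s ->
    (forall j, (j < m.*2 - l)%N -> fixes b s (diag_vec j)) ->
    exists N, ideal_span (P b s) (s ^+ N).
  by move=> sb; apply: (H m.*2) => // j; rewrite subnn.
elim: l => [_ {}b {}s sb fb|l IH ltl {}b {}s sb fb].
  have -> : b = s%:M.
    apply: diag_vec_ext => j; rewrite mul_scalar_mx.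
    by apply: (proj1 (fb j _)); rewrite subn0.
  exists 0; rewrite expr0 -[1]addr0 -[X in X + _]mulr1.
  by apply: ideal_span_cons; [exact: P_scalar|exact: ideal_span0].
have ltk : (m.*2 - l.+1 < m.*2)%N by lia.
pose k := Ordinal ltk; pose e := plane_sign k.
(* The reflections in [p 1] and [p (- 1)], the difference and the sum of [g] and s [diag_vec k],
   send [g] to s [diag_vec k] and to its negative. *)
pose g := b *m diag_vec k; pose p t := g - (t * s) *: diag_vec k.
have gg : form g g = 2%:R * (s ^+ 2 * e).
  rewrite {1}/g form_mulmxl mulmxA sb.1 mul_scalar_mx formZr form_diag_vec eqxx.
  by rewrite mulr1n mulrCA.
have kk : form (diag_vec k) (diag_vec k) = 2%:R * e by rewrite form_diag_vec eqxx.
set gk := form g (diag_vec k).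
have qp t : t * t = 1 -> qform h (p t) = 2%:R * (s ^+ 2 * e) - t * s * gk.
  move=> tt; rewrite /qform /p !formE gg kk (formC (diag_vec k)) -/gk.
  transitivity (2%:R * h * (2%:R * (s ^+ 2 * e) - t * s * gk) +
                h * (t * t - 1) * (2%:R * (s ^+ 2 * e))); first by ring.
  by rewrite h2 tt; ring.
have kj j : (j < m.*2 - l.+1)%N -> form (diag_vec k) (diag_vec j) = 0.
  move=> ltj; rewrite form_diag_vec; suff -> : (k == j) = false by [].
  by apply/eqP => /(congr1 val) /=; lia.
have pj t j : (j < m.*2 - l.+1)%N ->
    fixes (srefl h (p t) *m b) (qform h (p t) * s) (diag_vec j).
  move=> ltj; apply: fixes_srefl (fb j _); last by lia.
  rewrite /p !formE kj // /g form_mulmxl (fb j _).2; last by lia.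
  by rewrite formZr kj // !mulr0 subr0.
have pk t : t * t = 1 ->
    fixes (srefl h (p t) *m b) (t * (qform h (p t) * s)) (diag_vec k).
  move=> tt; split.
    rewrite -mulmxA srefl_mul -/g.
    have -> : form (p t) g = qform h (p t).
      by rewrite (qp _ tt) /p !formE gg formC -/gk.
    by rewrite -scalerBr /p subKr scalerA; congr (_ *: _); ring.
  have bg : adj b *m g = s ^+ 2 *: diag_vec k by rewrite mulmxA sb.1 mul_scalar_mx.
  rewrite adjM adj_srefl -mulmxA srefl_mul !(mulmxBr, mulmxDr, mulmxN, mulmx_scale) bg.
  rewrite (qp _ tt) /p !formE kk -/gk.
  move: (adj b *m _) => y; apply/matrixP=> i i'; rewrite !mxE.
  move: (y i i') (diag_vec k i i') => {}y z.
  transitivity (t * ((2%:R * (s ^+ 2 * e) - t * s * gk) * s) * z +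
                (1 - t * t) * (2%:R * (s ^+ 2 * e) * y - s ^+ 2 * gk * z)).
    by ring.
  by rewrite tt; ring.
have sp t := similitudeM (srefl_similitude h2 (p t)) sb.
have jl j : (j < m.*2 - l)%N -> (j < m.*2 - l.+1)%N \/ j = k.
  move=> ltj; have [|lej] := ltnP j (m.*2 - l.+1)%N; first by left.
  by right; apply: val_inj => /=; lia.
have [|N1 span1] := IH (ltnW ltl) _ _ (sp 1).
  by move=> j /jl[/pj|->] //; rewrite -[_ * s]mul1r; apply: pk; rewrite mulr1.
(* After the reflection in [p (- 1)] the vector [diag_vec k] is sent to its negative. A further
   reflection in [diag_vec k] itself restores the sign and keeps the earlier vectors fixed. *)
have sk := similitudeM (srefl_similitude h2 (diag_vec k)) (sp (- 1)).
have [|N2 span2] := IH (ltnW ltl) _ _ sk.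
  move=> j /jl[ltj|->].
    by apply: fixes_srefl (pj _ j ltj); exact: kj.
  have [k1 k2] := pk (- 1) (etrans (mulrNN _ _) (mulr1 _)).
  have E : srefl h (diag_vec k) *m diag_vec k = - e *: diag_vec k.
    by rewrite srefl_mul qform_diag_vec kk -scalerBl -/e; congr (_ *: _); ring.
  rewrite qform_diag_vec -/e; split.
    by rewrite -mulmxA k1 mulmx_scale E scalerA; congr (_ *: _); ring.
  by rewrite adjM adj_srefl -mulmxA E mulmx_scale k2 scalerA; congr (_ *: _); ring.
have := ideal_span_srefl sb (ideal_span_srefl (sp _) span2).
have := ideal_span_srefl sb span1.
have ee : e * e = 1 by exact: plane_sign_sq.
(* Neither summand need be invertible, but the sum is s^2 times a unit. *)
have qpr : qform h (p 1) + qform h (p (- 1)) = 4%:R * s ^+ 2 * e.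
  by rewrite !qp ?mulr1 ?mulrNN ?mulr1 //; ring.
rewrite qform_diag_vec -/e.
move: (qform h (p 1)) (qform h (p (- 1))) qpr => q r qr Iq Ir.
(* [K] dominates the exponents N1 + 4 of q and N2 + 4 of r, so that both branches reach the same
   power. *)
pose K := (N1 + N2 + 4)%N.
have {}Iq : ideal_span (P b s) (q ^+ K * s ^+ (N1 + N2)).
  have -> : q ^+ K * s ^+ (N1 + N2) = q ^+ N2 * s ^+ N2 * ((q * s) ^+ N1 * q ^+ 4).
    by rewrite exprMn /K !exprD; ring.
  exact: ideal_spanMl.
have {}Ir : ideal_span (P b s) (r ^+ K * s ^+ (N1 + N2)).
  have -> : r ^+ K * s ^+ (N1 + N2) = r ^+ N1 * s ^+ N1 * e ^+ N2 *
      ((e * (r * s)) ^+ N2 * e ^+ 4 * r ^+ 4).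
    transitivity (r ^+ K * s ^+ (N1 + N2) * (e * e) ^+ N2 * (e * e) ^+ 2).
      by rewrite ee !expr1n !mulr1.
    by rewrite !exprMn /K !exprD; ring.
  exact: ideal_spanMl.
(* Since 4 h^2 = 1 and e^2 = 1, the product h^2 e (q + r) is s^2; it is raised to the power K + K
   required by [ideal_span_exp_add]. *)
exists (2 * (K + K) + (N1 + N2))%N.
have -> : s ^+ (2 * (K + K) + (N1 + N2)) =
    (h * h * e) ^+ (K + K) * ((q + r) ^+ (K + K) * s ^+ (N1 + N2)).
  rewrite qr mulrA -exprMn [in LHS]exprD exprM; congr (_ ^+ _ * _).
  transitivity ((2%:R * h) * (2%:R * h) * (e * e) * s ^+ 2); last by ring.
  by rewrite h2 ee !mul1r.
by apply: ideal_spanMl; exact: ideal_span_exp_add.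
Qed.

End Elimination.

(** * Transvections as elementary orthogonal matrices *)

Section CastSquare.
Variables (A : comNzRingType) (n n' : nat) (e : n = n').

Lemma castmx_mul (a b : 'M[A]_n) :
  castmx (e, e) (a *m b) = castmx (e, e) a *m castmx (e, e) b.
Proof. by case: _ / e. Qed.

Lemma castmx1 : castmx (e, e) 1%:M = 1%:M :> 'M[A]_n'.
Proof. by case: _ / e. Qed.

Lemma castmx_delta i j :
  castmx (e, e) (delta_mx i j) = delta_mx (cast_ord e i) (cast_ord e j) :> 'M[A]_n'.
Proof. by case: _ / e; rewrite castmx_id !cast_ord_id. Qed.

Lemma castmxD (a b : 'M[A]_n) :
  castmx (e, e) (a + b) = castmx (e, e) a + castmx (e, e) b.
Proof. by case: _ / e. Qed.

Lemma castmxZ k (a : 'M[A]_n) : castmx (e, e) (k *: a) = k *: castmx (e, e) a.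
Proof. by case: _ / e. Qed.

End CastSquare.

Section Elementary.
Variables (A : comNzRingType) (m : nat) (h : A).
Hypothesis h2 : 2%:R * h = 1.

Lemma dual_delta k : dual (delta_mx k 0) = delta_mx 0 (sigma k) :> 'rV[A]_(m.*2).
Proof.
rewrite dualE trmx_delta -rowE; apply/rowP=> j.
by rewrite !mxE phiE [k == _]eq_sym (can2_eq (@sigmaK m) (@sigmaK m)).
Qed.

Lemma qform_delta k z : qform h (z *: delta_mx k 0 : 'cV[A]_(m.*2)) = 0.
Proof. by rewrite /qform !formE form_delta sigma_neq !mulr0. Qed.

Lemma transv_delta i k z :
  transv h i (z *: delta_mx k 0) =
  1%:M + z *: delta_mx (lshift 2 k) (rshift (m.*2) (rev_ord i))
    - z *: delta_mx (rshift (m.*2) i) (lshift 2 (sigma k)).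
Proof.
rewrite /transv qform_delta scale0r subr0 pdualE dualZ dual_delta mul_scalemx mulmx_scale.
rewrite !mul_delta_mx.
apply/matrixP=> a b; rewrite -[a]splitK -[b]splitK.
case: (split a) (split b) => [x|x] [y|y] /=;
  rewrite !(block_mxEul, block_mxEur, block_mxEdl, block_mxEdr, mxE, eq_shift) /=;
  by rewrite ?(andbF, andFb) ?(mulr0n, mulr0, oppr0, addr0, add0r, subr0).
Qed.

(** Transvections along a fixed isotropic vector add. On a multiple of a basis vector q vanishes,
    and the transvection is a single [oe]. *)
Lemma transv_elementary i (w : 'cV[A]_(m.*2)) :
  elementary_orthogonal_group
    (castmx (double_add2 m, double_add2 m) (transv h i w) : 'M_(m.+1.*2)).
Proof.
rewrite [w]matrix_sum_delta.
apply: (big_ind (fun v => elementary_orthogonal_group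
  (castmx _ (transv h i v) : 'M_(m.+1.*2)))).
- by rewrite transv0 castmx1; exact: generated_one.
- by move=> v1 v2 E1 E2; rewrite -(transvD h2) castmx_mul; exact: generated_mul.
move=> k _; rewrite big_ord1; apply: generated_in.
set e := double_add2 m.
exists (cast_ord e (lshift 2 k)), (cast_ord e (rshift (m.*2) (rev_ord i))), (w k 0).
have ltk := ltn_ord k.
have sig : sigma (cast_ord e (rshift (m.*2) (rev_ord i)) : 'I_(m.+1.*2)) =
    cast_ord e (rshift (m.*2) i).
  apply: val_inj; rewrite /= sigma_natD2; congr addn.
  by case: i => [[|[|i]] //=].
split.
- by rewrite -val_eqE /= neq_ltn ltn_addr.
- by rewrite sig -val_eqE /= neq_ltn ltn_addr.
rewrite transv_delta /oe castmxD castmxD -scaleNr !castmxZ castmx1 !castmx_delta sig scaleNr.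
by congr (_ - _ *: delta_mx _ _); apply: val_inj.
Qed.

Lemma stably_elementary_elementary (a : 'M[A]_(m.*2)) :
  stably_elementary h a -> elementary_orthogonal_group (perp2 a 1%:M).
Proof.
rewrite /perp2; elim=> [_ [i [w ->]] | | x y _ IHx _ IHy | x y _ IHx [xy yx]].
- exact: transv_elementary.
- by rewrite castmx1; exact: generated_one.
- by rewrite castmx_mul; exact: generated_mul.
by apply: generated_inv IHx _; split; rewrite -castmx_mul ?xy ?yx castmx1.
Qed.

End Elementary.

(** * Change of rings *)

Section BaseChange.
Variables (R A : comNzRingType) (m : nat) (f : {rmorphism R -> A}).
Implicit Types (a b eta : 'M[R]_(m.*2)) (u : 'cV[R]_(m.*2)).

Lemma map_phi : map_mx f (phi R m) = phi A m.
Proof. by apply/matrixP=> i j; rewrite mxE !phiE rmorph_nat. Qed.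

Lemma map_adj b : map_mx f (adj b) = adj (map_mx f b).
Proof. by rewrite !adjE !map_mxM map_phi map_trmx. Qed.

Lemma isometry_map b : isometry b -> isometry (map_mx f b).
Proof. by move=> [b1 b2]; split; rewrite -map_adj -map_mxM ?b1 ?b2 map_mx1. Qed.

Lemma congruence_map c eta : congruence c eta -> congruence (f c) (map_mx f eta).
Proof.
move=> [e1 e2]; split; rewrite -map_adj -map_mxM -map_mxZ -!map_mxD.
  by rewrite e1 map_mx0.
by rewrite e2 map_mx0.
Qed.

Lemma map_dual u : map_mx f (dual u) = dual (map_mx f u).
Proof. by rewrite !dualE map_mxM map_phi map_trmx. Qed.

Lemma qform_map h u : qform (f h) (map_mx f u) = f (qform h u).
Proof. by rewrite /qform rmorphM /form -map_dual -map_mxM mxE. Qed.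

Lemma map_srefl h u : map_mx f (srefl h u) = srefl (f h) (map_mx f u).
Proof. by rewrite /srefl map_mxB map_scalar_mx map_mxM map_dual qform_map. Qed.

Lemma similitude_map b s : similitude b s -> similitude (map_mx f b) (f s).
Proof.
by move=> [b1 b2]; split; rewrite -map_adj -map_mxM ?b1 ?b2 map_scalar_mx rmorphXn.
Qed.

(** Moduli are taken in R while goodness is tested over A. This serves both for the embedding of
    constants into polynomials and for the identity. *)
Lemma ideal_span_good h b s : 2%:R * h = 1 -> similitude b s ->
  exists N, ideal_span (fun d => good (f h) (map_mx f b) (f s) (f d)) (s ^+ N).
Proof.
move=> h2.
have fh2 : 2%:R * f h = 1 by rewrite -(rmorph_nat f 2) -rmorphM h2 rmorph1.
apply: (ideal_span_similitude h2
  (P := fun b s d => good (f h) (map_mx f b) (f s) (f d))) => {b s}.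
  by move=> s d; rewrite map_scalar_mx; exact: good_scalar.
move=> u b s d sb gd.
set q := qform h u in gd *.
(* Applying the scaled reflection twice multiplies [b] by k = q^2, and removing this scalar costs
   k^2 in the modulus. *)
have -> : q ^+ 4 = (q ^+ 2) ^+ 2 by rewrite -exprM.
rewrite rmorphM rmorphXn; apply: good_unscale.
have -> : f (q ^+ 2) *: map_mx f b = map_mx f (srefl h u) *m map_mx f (srefl h u *m b).
  by rewrite -map_mxM mulmxA (srefl_sq h2) mul_scalar_mx map_mxZ.
rewrite expr2 -rmorphM -mulrA rmorphM.
apply: good_mul gd.
  by apply: similitude_map; apply: similitudeM sb; exact: srefl_similitude.
by rewrite map_srefl -qform_map; exact: good_srefl.
Qed.

End BaseChange.

(** * Homotopies in the polynomial variable *)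

Lemma scaleX_eq0 (A : comNzRingType) p q (x : 'M[{poly A}]_(p, q)) :
  'X *: x = 0 -> x = 0.
Proof.
move=> /matrixP x0; apply/matrixP=> i j; apply/polyP=> k.
by have := x0 i j; rewrite !mxE => /polyP/(_ k.+1); rewrite coefXM !coef0.
Qed.

(** Write g = 1 + X eta. The regular element X can be cancelled from the isometry equations, and the
    resulting relations survive evaluation at [d], even if [d] is a zero divisor. *)
Lemma isometry_specialization (A : comNzRingType) m (g : 'M[{poly A}]_(m.*2)) d :
  isometry g -> map_mx (horner_eval 0) g = 1%:M ->
  exists2 eta, congruence d eta & map_mx (horner_eval d) g = 1%:M + d *: eta.
Proof.
move=> [g1 g2] g0; pose eta := map_mx (drop_poly 1) g.
have gE : g = 1%:M + 'X *: eta.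
  apply/matrixP=> i j; rewrite !mxE -{1}(poly_take_drop 1 (g i j)) expr1 mulrC.
  congr (_ + _); have /matrixP/(_ i j) := g0; rewrite !mxE /horner_eval horner_coef0.
  move=> E; apply/polyP=> -[|k]; rewrite coef_take_poly /= ?E.
    by rewrite -polyC_natr coefC.
  by rewrite -polyC_natr coefC.
have ce : congruence 'X eta.
  by apply: isometry_congruence; [exact: scaleX_eq0|rewrite -gE].
exists (map_mx (horner_eval d) eta).
  by have := congruence_map (horner_eval d) ce; rewrite /= /horner_eval hornerX.
by rewrite {1}gE map_mxD map_mx1 map_mxZ /= /horner_eval hornerX.
Qed.

Section Homotopy.
Variables (R : comNzRingType) (m : nat) (h : {poly R}).
Hypothesis h2 : 2%:R * h = 1.
Variables (a b : 'M[{poly R}]_(m.*2)) (P : {poly R} -> Prop).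
Hypotheses (ia : isometry a) (ib : isometry b).
Hypothesis gP : forall d, P d -> good h b 1 d.

Lemma isometry_comp t : isometry (map_mx (comp_poly t) a).
Proof. exact: isometry_map. Qed.

Lemma commute_mod_homotopy t :
  commute_mod h (map_mx (comp_poly 0) a) b -> ideal_span P t ->
  commute_mod h (map_mx (comp_poly ('X * t)) a) b.
Proof.
move=> c0; elim=> [|k d {}t Pd _ IH]; first by rewrite mulr0.
pose at_ := map_mx (comp_poly ('X * t)) a.
(* With Y the new variable, [g] below is a(X t + X k Y) a(X t)^-1. It is 1 at Y = 0, and at Y = d it
   is the quotient of two consecutive terms of the telescope. *)
pose psi : {rmorphism {poly R} -> {poly {poly R}}} :=
  comp_poly (('X * t)%:P + ('X * k)%:P * 'X) \o map_poly polyC.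
pose g := map_mx psi a *m adj (map_mx polyC at_).
have psiE x p : (psi p).[x] = p \Po ('X * t + 'X * k * x).
  by rewrite /psi /= horner_comp !hornerE.
have ig : isometry g.
  apply: isometryM; first exact: isometry_map.
  by apply: isometryV; apply: isometry_map; exact: isometry_comp.
have gE x : map_mx (horner_eval x) g =
    map_mx (comp_poly ('X * t + 'X * k * x)) a *m adj at_.
  rewrite map_mxM map_adj -!map_mx_comp; congr (_ *m adj _).
    by apply/matrixP=> i j; rewrite !mxE /= /horner_eval psiE.
  by apply/matrixP=> i j; rewrite !mxE /= /horner_eval hornerC.
have [|eta ce ge] := isometry_specialization d ig.
  by rewrite gE mulr0 addr0 (isometry_comp _).2.
have -> : map_mx (comp_poly ('X * (k * d + t))) a = (1%:M + d *: eta) *m at_.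
  rewrite -ge gE -mulmxA (isometry_comp _).1 mulmx1.
  by rewrite mulrDr addrC mulrA.
apply: commute_modMl => //; first by rewrite -ge; exact: isometry_map.
exact: good_commute (gP Pd) ce ib.
Qed.

End Homotopy.

(** * Maximal ideals and units of a local ring *)

Section LocalRing.
Local Open Scope classical_set_scope.
Variable R : comNzRingType.

Lemma maximal_ideal_exists (x : R) : ~ (exists y, x * y = 1) ->
  exists N : R -> Prop, is_maximal_ideal N /\ N x.
Proof.
move=> nx; pose proper (I : R -> Prop) := [/\ is_ideal I, ~ I 1 & I x].
pose Q (I : set R) := I = set0 \/ proper I.
have [|A [QA maxA]] := @Zorn_bigcup R Q.
  move=> F FQ totF.
  have [[X0 [FX0 PX0]]|noP] := pselect (exists X, F X /\ proper X); last first.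
    left; rewrite -subset0 => z [X FX Xz].
    by have [X0|PX] := FQ _ FX; [rewrite X0 in Xz|case: noP; exists X].
  have PX X z : F X -> X z -> proper X.
    by move=> /FQ[-> //|].
  right; split; last by exists X0 => //; case: PX0.
    split; first by exists X0 => //; case: PX0 => [[]].
      move=> y z [Y FY Yy] [Z FZ Zz].
      have [YZ|ZY] := totF _ _ FY FZ.
        by exists Z => //; have [[_ + _] _ _] := PX _ _ FZ Zz; apply=> //; exact: YZ.
      by exists Y => //; have [[_ + _] _ _] := PX _ _ FY Yy; apply=> //; exact: ZY.
    by move=> k z [Z FZ Zz]; exists Z => //; have [[_ _ +] _ _] := PX _ _ FZ Zz; exact.
  by move=> [Z FZ Z1]; have [] := PX _ _ FZ Z1.
have [A0|[idA A1 Ax]] := QA; last first.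
  exists A; split=> //; split=> // J idJ J1 AJ z Jz; apply: contrapT => nAz.
  apply: (maxA J); last by right; split=> //; exact: AJ.
  by split=> // /(_ _ Jz).
(* The maximal set is not empty, since the multiples of x form a proper ideal. *)
exfalso; apply: (maxA (fun z => exists k, z = k * x)).
  by rewrite A0; split=> [z []|/(_ 0)]; apply; exists 0; rewrite mul0r.
right; split; last by exists 1; rewrite mul1r.
  split; first by exists 0; rewrite mul0r.
    by move=> _ _ [k ->] [l ->]; exists (k + l); rewrite mulrDl.
  by move=> k _ [l ->]; exists (k * l); rewrite mulrA.
by move=> [k xk]; apply: nx; exists k; rewrite mulrC.
Qed.

(** If no element of [P] were a unit, each would lie in a maximal ideal, hence in [M], and so would
    1. *)
Lemma local_ideal_span1 (P : R -> Prop) : is_local_ring R ->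
  ideal_span P 1 -> exists2 d, P d & exists y, d * y = 1.
Proof.
move=> [M [[idM M1 _] uniqM]] span1; apply: contrapT => noP; apply: M1.
have [M0 MD MM] := idM; elim: span1 => // k d t Pd _ Mt.
apply: MD Mt; apply: MM; have [N [maxN Nd]] : exists N, is_maximal_ideal N /\ N d.
  by apply: maximal_ideal_exists => dy; apply: noP; exists d.
by apply/(uniqM _ maxN).
Qed.

End LocalRing.

(** * Isometries over polynomials with local coefficients *)

Section LocalPolynomials.
Variables (R : comNzRingType) (m : nat) (h : R).
Hypotheses (hR : is_local_ring R) (h2 : 2%:R * h = 1).
Implicit Types a b : 'M[{poly R}]_(m.*2).

Lemma polyC_half : 2%:R * h%:P = 1 :> {poly R}.
Proof. by rewrite -(rmorph_nat polyC 2) -rmorphM /= h2. Qed.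

(** The roles are exchanged: the moduli are those of [c] and lie in R, where one of them is a unit.
    Modulo a unit every [b] is congruent to 1. *)
Lemma commute_mod_const (c : 'M[R]_(m.*2)) b : isometry c -> isometry b ->
  commute_mod h%:P (map_mx polyC c) b.
Proof.
move=> ic ib.
have [|N] := @ideal_span_good _ {poly R} m polyC h c 1 h2.
  by rewrite /similitude expr1n; exact: ic.
rewrite expr1n => /(local_ideal_span1 hR)[d gd [y dy]].
have iC := isometry_map polyC ic.
apply: commute_mod_sym => //.
pose eta := y%:P *: (b - 1%:M).
have dyC : d%:P * y%:P = 1 by rewrite -rmorphM /= dy.
have bE : b = 1%:M + d%:P *: eta by rewrite scalerA dyC scale1r addrC subrK.
rewrite bE; apply: good_commute gd _ iC.
apply: isometry_congruence; last by rewrite -bE.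
by move=> x /(congr1 ( *:%R y%:P)); rewrite scaler0 scalerA mulrC dyC scale1r.
Qed.

Lemma commute_mod_isometry a b : isometry a -> isometry b ->
  commute_mod h%:P a b.
Proof.
move=> ia ib; have hP := polyC_half.
have [|N] := @ideal_span_good _ {poly R} m idfun h%:P b 1 hP.
  by rewrite /similitude expr1n; exact: ib.
rewrite expr1n => span1.
(* The homotopy ends at t = 1, which [span1] writes as a combination of moduli for [b]. *)
have -> : a = map_mx (comp_poly ('X * 1)) a.
  by apply/matrixP=> i j; rewrite mxE mulr1 comp_polyXr.
apply: commute_mod_homotopy span1 => //.
  by move=> d; rewrite map_mx_id.
have -> : map_mx (comp_poly 0) a = map_mx polyC (map_mx (horner_eval 0) a).
  by apply/matrixP=> i j; rewrite !mxE /= comp_poly0r /horner_eval horner_coef0.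
by apply: commute_mod_const => //; exact: isometry_map.
Qed.

End LocalPolynomials.

(** * From the orthogonal group to isometries *)

Lemma orthogonal_isometry (A : comNzRingType) m (a : 'M[A]_(m.*2)) :
  orthogonal_group a -> isometry a.
Proof.
move=> [[b [ab _]] oa].
have a1 : adj a *m a = 1%:M.
  by rewrite adjE -!mulmxA [a^T *m _]mulmxA oa phi_sq.
have E : adj a = b by rewrite -[LHS]mulmx1 -ab mulmxA a1 mul1mx.
by split=> //; rewrite E.
Qed.

Lemma inverse_adj (A : comNzRingType) m (a b : 'M[A]_(m.*2)) :
  isometry a -> is_inverse_mx a b -> b = adj a.
Proof. by move=> [a1 _] [ab _]; rewrite -[LHS]mul1mx -a1 -mulmxA ab mulmx1. Qed.

Theorem theorem1p6 (m : nat) (R : comNzRingType) (hm : (3 <= m)%N)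
    (hR : is_local_ring R) (h2 : exists h : R, 2%:R * h = 1)
    (a : 'M[{poly R}]_(m.*2))
    (ha : commutator_subgroup (@orthogonal_group _ m) (@orthogonal_group _ m) a) :
  elementary_orthogonal_group (perp2 a 1%:M).
Proof.
have [h hh] := h2.
apply: (stably_elementary_elementary (polyC_half hh)).
elim: ha => [_ [b [b' [c [c' [ob oc ib ic ->]]]]] | | x y _ IHx _ IHy | x y _ IHx [xy yx]].
- have [ob' oc'] := (orthogonal_isometry ob, orthogonal_isometry oc).
  rewrite (inverse_adj ob' ib) (inverse_adj oc' ic).
  exact: commute_mod_isometry.
- exact: stably_elementary1.
- exact: stably_elementaryM.
exact: stably_elementaryV xy yx IHx.
Qed.
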